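(* Let $f_1,f_2:[0,1]\times\mathbb{R}^2\to\mathbb{R}$ be continuous functions and let $\alpha,\beta:(C[0,1])^2\to\mathbb{R}$ be (not necessarily linear) continuous functionals. Assume there are nonnegative constants $a_1,b_1,a_2,b_2,A_1,B_1,A_2,B_2$ such that $$|f_1(t,x,y)-f_1(t,\overline{x},\overline{y})|\le a_1|x-\overline{x}|+b_1|y-\overline{y}|,\qquad |f_2(t,x,y)-f_2(t,\overline{x},\overline{y})|\le a_2|x-\overline{x}|+b_2|y-\overline{y}|$$ for all $t\in[0,1]$ and all $x,y,\overline{x},\overline{y}\in\mathbb{R}$, and $$|\alpha[x,y]-\alpha[\overline{x},\overline{y}]|\le A_1|x-\overline{x}|_C+B_1|y-\overline{y}|_C,\qquad |\beta[x,y]-\beta[\overline{x},\overline{y}]|\le A_2|x-\overline{x}|_C+B_2|y-\overline{y}|_C$$ for all $x,y,\overline{x},\overline{y}\in C[0,1]$. Assume in addition that for some $\theta>0$ the matrix $$M_\theta=\begin{bmatrix}\max\{\frac1\theta,\ a_1+\theta A_1\} & b_1+\theta B_1\\ a_2+\theta A_2 & \max\{\frac1\theta,\ b_2+\theta B_2\}\end{bmatrix}$$ is convergent to zero. Then the nonlocal problem $$\begin{cases}x'(t)=f_1(t,x(t),y(t)),\\ y'(t)=f_2(t,x(t),y(t)),\quad t\in[0,1],\\ x(0)=\alpha[x,y],\\ y(0)=\beta[x,y]\end{cases}$$ has a unique solution $(x,y)$.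
   Context: $C[0,1]$ is the space of continuous functions $[0,1]\to\mathbb{R}$, with norm $|x|_C=\max_{t\in[0,1]}|x(t)|$. A square matrix $M$ with nonnegative elements is said to be convergent to zero if $M^k\to 0$ as $k\to\infty$. A solution of the problem is a pair $(x,y)$ of continuously differentiable real functions on $[0,1]$ satisfying both differential equations on $[0,1]$ and both initial conditions; equivalently, a pair $(x,y)\in (C[0,1])^2$ with $x(t)=\alpha[x,y]+\int_0^t f_1(s,x(s),y(s))\,ds$ and $y(t)=\beta[x,y]+\int_0^t f_2(s,x(s),y(s))\,ds$ for all $t\in[0,1]$. *)

(* Defs.v *)
From HB Require Import structures.
From mathcomp Require Import all_boot all_order all_algebra.
From mathcomp Require Import all_classical all_reals all_analysis.

Set Implicit Arguments.
Unset Strict Implicit.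
Unset Printing Implicit Defensive.

Import Order.TTheory GRing.Theory Num.Theory.
Import numFieldNormedType.Exports.

Local Open Scope classical_set_scope.
Local Open Scope ring_scope.

(* As a type, [I01 R] is [set_type `[0, 1]], with the subset topology. *)
Definition I01 (R : realType) : set R := `[0, 1]%classic.
Arguments I01 R : clear implicits.

Lemma I01_0 (R : realType) : (0 : R) \in I01 R.
Proof. by rewrite inE /I01 /= in_itv /= lexx ler01. Qed.

Definition zero01 (R : realType) : I01 R := exist _ 0 (I01_0 R).
Arguments zero01 R : clear implicits.

Definition C01 (R : realType) : Type := continuousType (I01 R) R.

(* C[0,1] is given the topology (and the metric) of uniform convergence, i.e.,
   the one of the norm [normC] below. *)
Section C01_topology.
Import ArrowAsUniformType.
Variable R : realType.

HB.instance Definition _ := PseudoMetric.copy (C01 R)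
  (initial_topology (id : continuousType (I01 R) R -> (I01 R -> R))).

End C01_topology.

(* The supremum is a maximum when [h] is continuous, [0,1] being compact. *)
Definition normC (R : realType) (h : I01 R -> R) : R :=
  sup (range (fun t => `|h t|)).

(* [x'(t) = d] for a function defined on [0,1] only: [s] ranges over [0,1], so
   that the derivative is one-sided when [t] is an endpoint. *)
Definition has_derivative (R : realType) (x : I01 R -> R) (t : I01 R) (d : R) :
    Prop :=
  (x s - x t) / (\val s - \val t) @[s --> t^'] --> d.

Definition continuously_differentiable (R : realType) (x : C01 R) : Prop :=
  exists x' : C01 R, forall t, has_derivative x t (x' t).

Definition convergent_to_zero (R : realType) (n : nat) (M : 'M[R]_n.+1) :
    Prop :=
  M ^+ k @[k --> \oo] --> (0 : 'M[R]_n.+1).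

Definition M_theta (R : realType) (a1 b1 a2 b2 A1 B1 A2 B2 theta : R) :
    'M[R]_2 :=
  \matrix_(i, j)
    if i == 0 then
      if j == 0 then Num.max (1 / theta) (a1 + theta * A1) else b1 + theta * B1
    else
      if j == 0 then a2 + theta * A2 else Num.max (1 / theta) (b2 + theta * B2).

Definition is_solution (R : realType) (f1 f2 : I01 R * (R * R) -> R)
    (alpha beta : C01 R * C01 R -> R) (xy : C01 R * C01 R) : Prop :=
  let: (x, y) := xy in
  [/\ continuously_differentiable x /\ continuously_differentiable y,
      forall t, has_derivative x t (f1 (t, (x t, y t))),
      forall t, has_derivative y t (f2 (t, (x t, y t))),
      x (zero01 R) = alpha (x, y) &
      y (zero01 R) = beta (x, y)].

(* Main.v *)
Require Import Defs.
From HB Require Import structures.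
From mathcomp Require Import all_boot all_order all_algebra.
From mathcomp Require Import all_classical all_reals all_analysis.
From mathcomp Require Import ring lra.

Set Implicit Arguments.
Unset Strict Implicit.
Unset Printing Implicit Defensive.

Import Order.TTheory GRing.Theory Num.Theory.
Import numFieldNormedType.Exports.

Local Open Scope classical_set_scope.
Local Open Scope ring_scope.

(** The initial values are treated as extra unknowns. On quadruples
    (x, a, y, b), with x, y in C[0,1] and a, b real, consider the operator T
    sending (x, a, y, b) to (P, alpha[x,y], Q, beta[x,y]), where
    P(t) = a + int_0^t f1(s,x(s),y(s)) ds and
    Q(t) = b + int_0^t f2(s,x(s),y(s)) ds.
    Its fixed points are exactly the quadruples (x, x(0), y, y(0)) built from
    the solutions (x, y).

    Each half (x, a) is measured by |x|_C + theta |a| ([aug_dist]). Moving a by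
    k moves P by at most k, which is (1/theta) (theta k), and moving x moves P
    by at most a1 |x - x'|_C and theta alpha by at most theta A1 |x - x'|_C;
    hence the diagonal entry max(1/theta, a1 + theta A1). Thus T is Lipschitz
    for the vector-valued distance with matrix M_theta ([aug_dist_picard]), and
    Perov's theorem ([perov_fixed_point]) gives a unique fixed point.

    Perov's theorem reduces to the geometric series argument for scalar
    contractions: a nonnegative matrix M with M^k --> 0 has a left weight
    w >= 1 with w M <= q w for some q < 1 ([contracting_weights]), so T
    contracts the scalar distance obtained by summing the components with
    weights w.

    Integrals occur only in the existence of antiderivatives
    ([antiderivative]). All estimates on P and Q, and the uniqueness of the
    solution of x' = h, x(0) = a, come from the mean value inequality
    ([mean_value]) applied to differences. *)

(** * Fixed points for vector-valued distances *)

(** The weight is w = e (1 + M + ... + M^N), where e is the row of ones and N is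
    so large that e M^(N+1) <= 1/2 entrywise. The sum telescopes:
    w M = w - e + e M^(N+1) <= w - 1/2, and 1/2 is a fixed fraction of every
    entry of w. *)
Lemma contracting_weights (R : realType) (n : nat) (M : 'M[R]_n.+1) :
  (forall i j, 0 <= M i j) -> convergent_to_zero M ->
  exists (w : 'rV[R]_n.+1) (q : R),
    [/\ 0 <= q < 1, forall i, 1 <= w 0 i &
        forall j, (w *m M) 0 j <= q * w 0 j].
Proof.
move=> M_ge0 M_cvg0.
have MX_ge0 k : forall i j, 0 <= (M ^+ k) i j.
  elim: k => [|k IHk] i j; first by rewrite expr0 mxE ler0n.
  by rewrite exprS mxE sumr_ge0 // => l _; rewrite mulr_ge0.
pose c : R := (n.+1%:R * 2)^-1.
have c_gt0 : 0 < c by rewrite invr_gt0 mulr_gt0 // ltr0n.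
have [N _ MN] : \forall k \near \oo, ball (0 : 'M[R]_n.+1) c (M ^+ k).
  by move/cvg_ballP : M_cvg0; exact.
pose e : 'rV[R]_n.+1 := const_mx 1.
pose w := \sum_(k < N.+1) e *m M ^+ k.
have eMX_ge0 k i : 0 <= (e *m M ^+ k) 0 i.
  by rewrite mxE sumr_ge0 // => l _; rewrite mulr_ge0 // mxE.
have wE : w *m M = w - e + e *m M ^+ N.+1.
  rewrite /w mulmx_suml [in RHS]big_ord_recl expr0 mulmx1 [e + _]addrC addrK.
  rewrite big_ord_recr /= -mulmxA -[M ^+ N *m M]exprSr; congr (_ + _).
  by apply: eq_bigr => i _; rewrite -mulmxA -[M ^+ i *m M]exprSr.
have w_ge1 i : 1 <= w 0 i.
  rewrite /w big_ord_recl expr0 mulmx1 mxE [e _ _]mxE lerDl summxE sumr_ge0 //.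
have eMN j : (e *m M ^+ N.+1) 0 j <= 2^-1.
  rewrite mxE (@le_trans _ _ (\sum_(l < n.+1) c)) //.
    apply: ler_sum => l _; rewrite mxE mul1r.
    have := MN N.+1 (leqnSn N) => -[_ /(_ l j)].
    by rewrite /ball /= !mxE sub0r normrN ger0_norm // => /ltW.
  rewrite sumr_const card_ord -[X in X <= _]mulr_natl /c invfM mulVKf //.
pose W := \sum_i w 0 i.
have wW j : w 0 j <= W.
  rewrite /W (bigD1 j) //= lerDl sumr_ge0 // => i _.
  exact: le_trans (w_ge1 i).
have W_ge1 : 1 <= W by exact: le_trans (w_ge1 0) (wW 0).
(* [W] bounds every entry of [w], so [w 0 j - 1/2 <= (1 - 1/(2W)) * w 0 j]. *)
exists w, (1 - 2^-1 / W); split => //.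
  have W_gt0 : 0 < W by lra.
  have : 2^-1 / W <= 2^-1 by rewrite ler_pdivrMr // ler_peMr // invr_ge0.
  have : 0 < 2^-1 / W by rewrite divr_gt0 // invr_gt0.
  lra.
move=> j; rewrite wE !mxE.
have -> : \sum_l e 0 l * (M ^+ N.+1) l j = (e *m M ^+ N.+1) 0 j by rewrite mxE.
have W_gt0 : 0 < W by lra.
have : 2^-1 / W * w 0 j <= 2^-1.
  rewrite mulrAC ler_pdivrMr // ler_wpM2l // invr_ge0 //.
have := eMN j; lra.
Qed.

(** Perov's fixed point theorem. Completeness is asked of sequences with an
    explicit rate [e], which is how the iterates arise and what passes to
    components of a product. *)
Theorem perov_fixed_point (R : realType) (n : nat) (X : Type)
    (D : X -> X -> 'I_n.+1 -> R) (M : 'M[R]_n.+1) (T : X -> X) (x0 : X) :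
  (forall x y i, 0 <= D x y i) ->
  (forall x y, (forall i, D x y i = 0) <-> x = y) ->
  (forall x y i, D x y i = D y x i) ->
  (forall x y z i, D x z i <= D x y i + D y z i) ->
  (forall (u : nat -> X) (e : nat -> R), e @ \oo --> 0 ->
     (forall m k i, D (u m) (u (m + k)%N) i <= e m) ->
     exists l, forall i, D (u m) l i @[m --> \oo] --> 0) ->
  (forall i j, 0 <= M i j) -> convergent_to_zero M ->
  (forall x y i, D (T x) (T y) i <= \sum_j M i j * D x y j) ->
  exists! x, T x = x.
Proof.
move=> D_ge0 D_eq0 D_sym D_tri D_complete M_ge0 M_cvg0 T_lip.
have [w [q [/andP[q_ge0 q_lt1] w_ge1 wM]]] := contracting_weights M_ge0 M_cvg0.
have w_ge0 i : 0 <= w 0 i by exact: le_trans (w_ge1 i).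
pose d x y := \sum_i w 0 i * D x y i.
have d_ge0 x y : 0 <= d x y by apply: sumr_ge0 => i _; exact: mulr_ge0.
have d_sym x y : d x y = d y x by apply: eq_bigr => i _; rewrite D_sym.
have d_tri x y z : d x z <= d x y + d y z.
  by rewrite -big_split /=; apply: ler_sum => i _; rewrite -mulrDr ler_wpM2l.
have D_le_d x y i : D x y i <= d x y.
  rewrite (le_trans (ler_peMl (D_ge0 x y i) (w_ge1 i))) //.
  rewrite /d (bigD1 i) //= lerDl; apply: sumr_ge0 => j _; exact: mulr_ge0.
have d_eq0 x y : d x y = 0 -> x = y.
  move=> dxy; apply/D_eq0 => i; apply/eqP.
  by rewrite eq_le D_ge0 andbT -dxy D_le_d.
have d_lip x y : d (T x) (T y) <= q * d x y.
  apply: (@le_trans _ _ (\sum_i w 0 i * \sum_j M i j * D x y j)).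
    by apply: ler_sum => i _; rewrite ler_wpM2l.
  rewrite (eq_bigr (fun i => \sum_j w 0 i * M i j * D x y j)); last first.
    by move=> i _; rewrite mulr_sumr; apply: eq_bigr => j _; rewrite mulrA.
  rewrite exchange_big /= /d mulr_sumr; apply: ler_sum => j _.
  rewrite -mulr_suml mulrA ler_wpM2r //.
  by have := wM j; rewrite mxE.
(* [C] is the sum of the geometric series that bounds the steps. *)
pose u k := iter k T x0; pose C := d (u 0%N) (u 1%N) / (1 - q).
have C_ge0 : 0 <= C by rewrite divr_ge0 // subr_ge0 ltW.
have step k : d (u k) (u k.+1) <= q ^+ k * ((1 - q) * C).
  elim: k => [|k IHk].
    by rewrite expr0 mul1r /C mulrC divfK // subr_eq0 gt_eqF.
  rewrite exprS -mulrA; apply: le_trans (d_lip _ _) _; exact: ler_wpM2l.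
have u_cauchy m k : d (u m) (u (m + k)%N) <= C * q ^+ m * (1 - q ^+ k).
  elim: k => [|k IHk].
    rewrite addn0 expr0 subrr mulr0 /d big1 // => i _.
    by rewrite (D_eq0 _ _).2 // mulr0.
  apply: (le_trans (d_tri _ (u (m + k)%N) _)); rewrite addnS.
  have := step (m + k)%N; rewrite exprD exprSr; nra.
have rate0 : C * q ^+ k @[k --> \oo] --> 0.
  rewrite -[X in _ --> X](mulr0 C); apply: cvgMl_tmp.
  by apply: cvg_expr; rewrite ger0_norm.
have [l ul] : exists l, forall i, D (u m) l i @[m --> \oo] --> 0.
  apply: (D_complete u _ rate0) => m k i.
  rewrite (le_trans (D_le_d _ _ _)) // (le_trans (u_cauchy _ _)) //.
  apply: ler_piMr; first by rewrite mulr_ge0 // exprn_ge0.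
  by rewrite gerBl exprn_ge0.
have dul : d (u m) l @[m --> \oo] --> 0.
  rewrite (_ : 0 = \sum_(i < n.+1) w 0 i * 0); last first.
    by rewrite big1 // => i _; rewrite mulr0.
  apply: cvg_big => [|i _]; first exact: add_continuous.
  apply: cvgMl_tmp; exact: ul.
have Tl : T l = l.
  apply: d_eq0; apply/eqP; rewrite eq_le d_ge0 andbT.
  have lim0 : q * d (u m) l + d (u m.+1) l @[m --> \oo] --> 0.
    rewrite -[X in _ --> X]addr0 -[X in _ --> X + _](mulr0 q); apply: cvgD.
      exact: cvgMl_tmp.
    by rewrite (cvg_shiftS (fun m => d (u m) l)).
  apply: (cvgr_to_ge lim0).
  apply: nearW => m /=.
  apply: (le_trans (d_tri _ (u m.+1) _)); rewrite lerD2r d_sym; exact: d_lip.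
exists l; split=> // l' Tl'; apply: d_eq0; apply/eqP; rewrite eq_le d_ge0 andbT.
by have := d_lip l l'; rewrite Tl Tl'; have := d_ge0 l l'; nra.
Qed.

(** * Functions on the unit interval as functions on the line *)

Lemma clamp_in01 (R : realType) (r : R) : Num.max 0 (Num.min r 1) \in I01 R.
Proof.
by rewrite inE /I01 /= in_itv /= le_max lexx ge_max ler01 ge_min lexx orbT.
Qed.

(** Composing with this retraction extends a continuous function on [0,1] to a
    continuous function on the line, to which the calculus of one real variable
    applies. *)
Definition clamp (R : realType) (r : R) : I01 R :=
  exist _ (Num.max 0 (Num.min r 1)) (clamp_in01 r).

Lemma I01P (R : realType) (t : I01 R) : 0 <= \val t <= 1.
Proof. by case: t => r /= /set_mem. Qed.

Lemma clampE (R : realType) (r : R) : 0 <= r <= 1 -> \val (clamp r) = r.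
Proof. by move=> /andP[r0 r1] /=; rewrite min_l // max_r. Qed.

Lemma clampK (R : realType) (t : I01 R) : clamp (\val t) = t.
Proof. by apply: val_inj; rewrite clampE // I01P. Qed.

Lemma val01_continuous (R : realType) : continuous (\val : I01 R -> R).
Proof. exact: initial_continuous. Qed.

Lemma clamp_continuous (R : realType) : continuous (@clamp R).
Proof.
apply: continuous_comp_initial => r.
apply: (@continuous_max _ _ (fun=> 0) (fun z : R => Num.min z 1)).
  exact: cvg_cst.
apply: (@continuous_min _ _ id (fun=> 1)); [exact: cvg_id|exact: cvg_cst].
Qed.

Lemma continuous_clamp_comp (R : realType) (h : I01 R -> R) :
  continuous h -> continuous (h \o @clamp R).
Proof.
move=> h_cont r; apply: continuous_comp; first exact: clamp_continuous.
exact: h_cont.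
Qed.

(** Continuity is used for the boundedness of [h]: the supremum of an unbounded
    set is a default value. *)
Lemma le_normC (R : realType) (h : I01 R -> R) (t : I01 R) :
  continuous h -> `|h t| <= normC h.
Proof.
move=> h_cont; apply: ub_le_sup; last by exists t.
have g_cont : {within `[0, 1], continuous (fun r : R => `|h (clamp r)|)}.
  apply: continuous_subspaceT => r.
  apply: (@continuous_comp _ _ _ (h \o @clamp R) (fun z : R => `|z|)).
    exact: continuous_clamp_comp.
  exact: norm_continuous.
have [c _ c_max] := EVT_max ler01 g_cont.
exists `|h (clamp c)| => _ [s _ <-].
by have := c_max (\val s) (I01P s); rewrite clampK.
Qed.

Lemma normC_le (R : realType) (h : I01 R -> R) (K : R) :
  (forall t, `|h t| <= K) -> normC h <= K.
Proof.
move=> hK; apply: sup_le_ub; first by exists `|h (zero01 R)|, (zero01 R).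
by move=> _ [t _ <-].
Qed.

Lemma cvg_dnbhs (S : Type) (T : topologicalType) (F : set_system S)
    (FF : Filter F) (f : S -> T) (y : T) :
  f @ F --> y -> (\forall s \near F, f s != y) -> f @ F --> y^'.
Proof.
move=> fy fNy U yU; apply: filterS2 fNy (fy _ yU) => s /= sNy; exact.
Qed.

(** * Derivatives on the unit interval *)

(** The two notions of derivative correspond through the change of variable
    h = s - t. *)
Lemma has_derivative_comp_val (R : realType) (F : R -> R) (t : I01 R) (d : R) :
  is_derive (\val t) 1 F d -> has_derivative (F \o \val) t d.
Proof.
move=> [F_ex <-].
have h0 : (\val s - \val t) @[s --> t^'] --> 0^'.
  apply: cvg_dnbhs.
    rewrite -(subrr (\val t)); apply: cvgB; last exact: cvg_cst.
    by apply: cvg_within_filter; exact: val01_continuous.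
  apply: filterS (@nbhs_dnbhs_neq _ t) => s st; rewrite subr_eq0.
  by apply: contra_neq st => /val_inj.
apply: (cvg_trans _ (cvg_comp _ _ h0 F_ex)); apply: near_eq_cvg; near=> s.
by rewrite /= [_%:A]mulr1 subrK /GRing.scale /= mulrC.
Unshelve. all: by end_near. Qed.

(** Only interior points are concerned: at the endpoints the extension by
    [clamp] is in general not differentiable. *)
Lemma has_derivative_clamp (R : realType) (x : I01 R -> R) (r d : R) :
  0 < r < 1 -> has_derivative x (clamp r) d -> is_derive r 1 (x \o @clamp R) d.
Proof.
move=> /andP[r0 r1] xd.
have rE : \val (clamp r) = r by rewrite clampE // !ltW.
suff dq : (fun h => h^-1 *: (((x \o @clamp R) \o shift r) (h *: 1)
                             - (x \o @clamp R) r)) @ 0^' --> d.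
  by split; [apply/cvg_ex; exists d|exact: cvg_lim].
have in01 : \forall h \near (0 : R)^', 0 <= h + r <= 1.
  near=> h; apply/andP.
  have : `|h| < Num.min r (1 - r).
    by near: h; apply: dnbhs0_lt; rewrite lt_min r0 subr_gt0.
  by rewrite lt_min !ltr_norml; lra.
have cr : clamp (h + r) @[h --> (0:R)^'] --> (clamp r)^'.
  apply: cvg_dnbhs.
    apply: (@cvg_comp _ _ _ (fun h => h + r) (@clamp R) _ (nbhs r)).
      suff : h + r @[h --> (0 : R)^'] --> 0 + r by rewrite add0r.
      apply: cvgD; last exact: cvg_cst.
      by apply: cvg_within_filter; exact: cvg_id.
    exact: clamp_continuous.
  near=> h; have hr : 0 <= h + r <= 1 by near: h.
  have h0 : h != 0 by near: h; exact: nbhs_dnbhs_neq.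
  apply: contra_neq h0 => /(congr1 val); rewrite rE clampE //; lra.
apply: (cvg_trans _ (cvg_comp _ _ cr xd)); apply: near_eq_cvg; near=> h.
have hr : 0 <= h + r <= 1 by near: h.
rewrite [h *: 1]mulr1 [LHS]mulrC rE (clampE hr) addrK.
Unshelve. all: by end_near. Qed.

Lemma antiderivative (R : realType) (h : I01 R -> R) (a : R) :
  continuous h ->
  exists x : C01 R, x (zero01 R) = a /\ forall t, has_derivative x t (h t).
Proof.
move=> h_cont; pose g := h \o @clamp R.
have g_cont : continuous g by exact: continuous_clamp_comp.
(* Integrating from [-1] puts every point of [0,1] in the interior of the domain
   of integration, so that the endpoints need no special treatment. *)
pose G (r : R) : R := Rintegral (@lebesgue_measure R) `[-1, r] g.
pose F (r : R) : R := G r + (a - G 0).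
have F_derive (t : R) : -1 < t -> is_derive t 1 F (g t).
  move=> t_gtN1; have tt1 : t < t + 1 by rewrite ltrDl.
  have gI : (@lebesgue_measure R).-integrable
      [set` Interval (BLeft (-1)) (BRight (t + 1))] (EFin \o g).
    apply: continuous_compact_integrable; first exact: segment_compact.
    exact: continuous_subspaceT.
  have [G_ex GE] := continuous_FTC1 tt1 gI t_gtN1 (g_cont t).
  rewrite -[g t]addr0; apply: is_deriveD.
  by apply: DeriveDef; [exact: G_ex|rewrite -derive1E; exact: GE].
have F_derive01 (t : I01 R) : is_derive (\val t) 1 F (h t).
  have /andP[t0 _] := I01P t.
  rewrite -[t in h t]clampK; apply: F_derive.
  by rewrite (lt_le_trans _ t0) // ltrN10.
have x_cont : continuous (F \o \val : I01 R -> R).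
  move=> t; apply: continuous_comp; first exact: val01_continuous.
  apply: differentiable_continuous; apply/derivable1_diffP.
  by have [] := F_derive01 t.
exists (mkcts x_cont); split; first exact: subrKC.
by move=> t; apply: has_derivative_comp_val.
Qed.

(** The mean value theorem for the extension of [x] to the line, on the segment
    from 0 to [t], whose length is at most 1. *)
Lemma mean_value (R : realType) (x x' : I01 R -> R) (K : R) :
  continuous x -> (forall t, has_derivative x t (x' t)) ->
  (forall t, `|x' t| <= K) ->
  forall t, `|x t - x (zero01 R)| <= K.
Proof.
move=> x_cont x_der x'K t; have /andP[t0 t1] := I01P t.
have zeroE : clamp 0 = zero01 R.
  by apply: val_inj; rewrite clampE // lexx ler01.
have [||c _ xE] := @MVT_segment R (x \o @clamp R) (x' \o @clamp R) _ _ t0.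
- move=> r; rewrite in_itv /= => /andP[r0 rt].
  apply: has_derivative_clamp; last exact: x_der.
  by rewrite r0 (lt_le_trans rt).
- by apply: continuous_subspaceT; exact: continuous_clamp_comp.
rewrite -zeroE -[t in x t]clampK [X in `|X|]xE subr0 normrM (ger0_norm t0).
apply: le_trans (x'K (clamp c)); exact: ler_piMr.
Qed.

Lemma has_derivativeB (R : realType) (x y : I01 R -> R) (t : I01 R) (d e : R) :
  has_derivative x t d -> has_derivative y t e ->
  has_derivative (x \- y) t (d - e).
Proof.
move=> xd ye; apply: (cvg_trans _ (cvgB xd ye)); apply: near_eq_cvg; near=> s.
by rewrite /= -mulrBl; congr (_ / _); rewrite opprD addrACA -opprD.
Unshelve. all: by end_near. Qed.

(** * The complete metric space of continuous functions *)

Lemma C01_continuous (R : realType) (x : C01 R) : continuous (x : I01 R -> R).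
Proof. exact: (@cts_fun _ _ x). Qed.

Lemma continuousB01 (R : realType) (x y : C01 R) :
  continuous (x \- y : I01 R -> R).
Proof.
have cB (f g : I01 R -> R) :
    continuous f -> continuous g -> continuous (f \- g).
  by move=> fc gc t; exact: (cvgB (fc t) (gc t)).
exact: (cB _ _ (@C01_continuous R x) (@C01_continuous R y)).
Qed.

(** Comparison of two initial value problems. It yields both the Lipschitz
    estimate for the integral operator and, with [K = 0], the uniqueness of the
    function with given derivative and initial value. *)
Lemma normC_ivp (R : realType) (x y : C01 R) (f g : I01 R -> R) (K : R) :
  (forall t, has_derivative x t (f t)) ->
  (forall t, has_derivative y t (g t)) ->
  (forall t, `|f t - g t| <= K) ->
  normC (x \- y) <= `|x (zero01 R) - y (zero01 R)| + K.
Proof.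
move=> xf yg fgK; apply: normC_le => t.
have := mean_value (@continuousB01 R x y)
  (fun t => has_derivativeB (xf t) (yg t)) fgK t.
rewrite /=; set p := x t - y t; set q := _ - y (zero01 R) => pq.
rewrite -[p](subrK q) (le_trans (ler_normD _ _)) // addrC lerD2l.
exact: pq.
Qed.

Lemma normC_ge0 (R : realType) (x y : C01 R) : 0 <= normC (x \- y).
Proof.
exact: le_trans (normr_ge0 _) (le_normC (zero01 R) (@continuousB01 R x y)).
Qed.

Lemma normC_eq0 (R : realType) (x y : C01 R) : normC (x \- y) = 0 <-> x = y.
Proof.
split=> [xy0|->].
  apply/continuousEP => t; apply/eqP; rewrite -subr_eq0 -normr_le0 -xy0.
  exact: (le_normC t (@continuousB01 R x y)).
apply/eqP; rewrite eq_le normC_ge0 andbT; apply: normC_le => t.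
by rewrite /= subrr normr0.
Qed.

Lemma normC_sym (R : realType) (x y : C01 R) : normC (x \- y) = normC (y \- x).
Proof.
suff le_sym (a b : C01 R) : normC (a \- b) <= normC (b \- a).
  by apply/eqP; rewrite eq_le !le_sym.
apply: normC_le => t; rewrite /= distrC.
exact: (le_normC t (@continuousB01 R b a)).
Qed.

Lemma normC_tri (R : realType) (x y z : C01 R) :
  normC (x \- z) <= normC (x \- y) + normC (y \- z).
Proof.
apply: normC_le => t; apply: (le_trans (ler_distD (y t) _ _)).
by apply: lerD; [exact: (le_normC t (@continuousB01 R x y))|
  exact: (le_normC t (@continuousB01 R y z))].
Qed.

Lemma rate_cvg (R : realType) (u e : nat -> R) :
  e @ \oo --> 0 -> (forall m k, `|u m - u (m + k)%N| <= e m) ->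
  exists l, forall m, `|u m - l| <= e m.
Proof.
move=> e0 u_cauchy.
have u_cvg : cvg (u @ \oo).
  apply/cauchy_cvgP; apply: cauchy_exP => eps eps_gt0.
  have [N _ eN] : \forall m \near \oo, e m < eps by exact: cvgr_lt e0 _ eps_gt0.
  exists (u N); exists N => // m /= Nm.
  rewrite /ball /= -(subnKC Nm); apply: le_lt_trans (u_cauchy _ _) _.
  exact: eN (leqnn N).
exists (lim (u @ \oo)) => m.
have : `|u m - u (m + k)%N| @[k --> \oo] --> `|u m - lim (u @ \oo)|.
  apply: cvg_norm; apply: cvgB; first exact: cvg_cst.
  have := u_cvg; rewrite -(cvg_shiftn m u); apply: cvg_trans.
  by apply: near_eq_cvg; apply: nearW => k; rewrite addnC.
by move/cvgr_to_le; apply; apply: nearW => k; exact: u_cauchy.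
Qed.

Lemma dist_continuousP (R : realType) (h : I01 R -> R) :
  continuous h <-> forall (s : I01 R) (eps : R), 0 < eps ->
    \forall t \near s, `|h s - h t| <= eps.
Proof.
have distP (s : I01 R) :=
  @cvgrPdist_le R R (I01 R) (nbhs s) (nbhs_filter s) h (h s).
by split=> [h_cont s|h_dist s]; apply/distP; [exact: h_cont|exact: h_dist].
Qed.

(** The pointwise limits satisfy the same rate [e] as the sequence, so the
    convergence is uniform and the limit is continuous. *)
Lemma C01_complete (R : realType) (u : nat -> C01 R) (e : nat -> R) :
  e @ \oo --> 0 -> (forall m k, normC (u m \- u (m + k)%N) <= e m) ->
  exists l : C01 R, forall m, normC (u m \- l) <= e m.
Proof.
move=> e0 u_cauchy.
have /choice[l ul] (t : I01 R) : exists l, forall m, `|u m t - l| <= e m.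
  apply: rate_cvg e0 _ => m k; apply: le_trans (u_cauchy m k).
  exact: (le_normC t (@continuousB01 R (u m) (u (m + k)%N))).
have l_cont : continuous l.
  apply/dist_continuousP => s eps eps_gt0.
  have [N _ eN] : \forall m \near \oo, e m < eps / 3.
    by apply: cvgr_lt e0 _ _; rewrite divr_gt0.
  have : \forall t \near s, `|u N s - u N t| <= eps / 3.
    have /dist_continuousP := @C01_continuous R (u N); apply.
    by rewrite divr_gt0.
  apply: filterS => t; have := ul s N; have := ul t N; have := eN N (leqnn N).
  rewrite !ler_norml; lra.
exists (mkcts l_cont) => m; apply: normC_le => t; exact: ul.
Qed.

(** * The initial value as an additional unknown *)

(** The distance of the norm |x|_C + theta |a| on C[0,1] x R. *)
Definition aug_dist (R : realType) (theta : R) (p q : C01 R * R) : R :=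
  normC (p.1 \- q.1) + theta * `|p.2 - q.2|.

Lemma aug_dist_ge0 (R : realType) (theta : R) (p q : C01 R * R) :
  0 < theta -> 0 <= aug_dist theta p q.
Proof.
by move=> theta_gt0; rewrite addr_ge0 ?normC_ge0 // mulr_ge0 // ltW.
Qed.

Lemma aug_dist_eq0 (R : realType) (theta : R) (p q : C01 R * R) :
  0 < theta -> aug_dist theta p q = 0 <-> p = q.
Proof.
move=> theta_gt0; split=> [/eqP|->]; last first.
  by rewrite /aug_dist subrr normr0 mulr0 addr0; apply/normC_eq0.
case: p q => [x a] [y b]; rewrite /aug_dist /=.
rewrite paddr_eq0 ?normC_ge0 //; last first.
  by rewrite mulr_ge0 // ltW.
rewrite mulf_eq0 [theta == 0]gt_eqF // normr_eq0 subr_eq0.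
by move=> /andP[/eqP/normC_eq0 -> /eqP ->].
Qed.

Lemma aug_dist_sym (R : realType) (theta : R) (p q : C01 R * R) :
  aug_dist theta p q = aug_dist theta q p.
Proof. by rewrite /aug_dist normC_sym distrC. Qed.

Lemma aug_dist_tri (R : realType) (theta : R) (p q r : C01 R * R) :
  0 < theta -> aug_dist theta p r <= aug_dist theta p q + aug_dist theta q r.
Proof.
move=> theta_gt0; rewrite /aug_dist addrACA -mulrDr.
apply: lerD; first exact: normC_tri.
by rewrite ler_pM2l //; exact: ler_distD.
Qed.

Lemma aug_dist_complete (R : realType) (theta : R)
    (u : nat -> C01 R * R) (e : nat -> R) :
  0 < theta ->
  e @ \oo --> 0 -> (forall m k, aug_dist theta (u m) (u (m + k)%N) <= e m) ->
  exists l, aug_dist theta (u m) l @[m --> \oo] --> 0.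
Proof.
move=> theta_gt0 e0 u_cauchy.
have [|x xP] := C01_complete (u := fun m => (u m).1) e0.
  move=> m k; apply: le_trans (u_cauchy m k).
  by rewrite lerDl mulr_ge0 // ltW.
have [||a aP] := rate_cvg (u := fun m => (u m).2)
  (e := fun m => theta^-1 * e m).
- by rewrite -[X in _ --> X](mulr0 theta^-1); exact: cvgMl_tmp.
- move=> m k; rewrite ler_pdivlMl //; apply: le_trans (u_cauchy m k).
  by rewrite lerDr normC_ge0.
exists (x, a).
have ee0 : e m + e m @[m --> \oo] --> 0.
  by rewrite -[X in _ --> X]addr0; exact: cvgD.
apply: (squeeze_cvgr _ (cvg_cst 0) ee0); apply: nearW => m.
apply/andP; split; first exact: aug_dist_ge0.
apply: lerD; first exact: xP.
by rewrite -ler_pdivlMl //; exact: aP.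
Qed.

(** One component of the operator T: [x] and [x'] are the antiderivatives
    produced from [(p, q)] and [(p', q')]. The difference of initial values is
    left as it is, since [p] and [q] exchange roles between the two
    components. *)
Lemma aug_dist_picard (R : realType) (theta a b A B : R)
    (f : I01 R * (R * R) -> R) (al : C01 R * C01 R -> R)
    (p q p' q' : C01 R * R) (x x' : C01 R) :
  0 < theta -> 0 <= a -> 0 <= b ->
  (forall (t : I01 R) (x y x' y' : R),
    `|f (t, (x, y)) - f (t, (x', y'))| <= a * `|x - x'| + b * `|y - y'|) ->
  (forall x y x' y' : C01 R,
    `|al (x, y) - al (x', y')| <= A * normC (x \- x') + B * normC (y \- y')) ->
  (forall t, has_derivative x t (f (t, (p.1 t, q.1 t)))) ->
  (forall t, has_derivative x' t (f (t, (p'.1 t, q'.1 t)))) ->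
  aug_dist theta (x, al (p.1, q.1)) (x', al (p'.1, q'.1)) <=
    `|x (zero01 R) - x' (zero01 R)| + (a + theta * A) * normC (p.1 \- p'.1)
      + (b + theta * B) * normC (q.1 \- q'.1).
Proof.
move=> theta_gt0 a_ge0 b_ge0 f_lip al_lip xf xf'.
have fK t : `|f (t, (p.1 t, q.1 t)) - f (t, (p'.1 t, q'.1 t))|
    <= a * normC (p.1 \- p'.1) + b * normC (q.1 \- q'.1).
  apply: le_trans (f_lip _ _ _ _ _) _; apply: lerD; apply: ler_wpM2l => //.
    exact: (le_normC t (@continuousB01 R p.1 p'.1)).
  exact: (le_normC t (@continuousB01 R q.1 q'.1)).
have x_le := normC_ivp xf xf' fK.
have al_le : theta * `|al (p.1, q.1) - al (p'.1, q'.1)|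
    <= theta * (A * normC (p.1 \- p'.1) + B * normC (q.1 \- q'.1)).
  by rewrite ler_pM2l.
apply: le_trans (lerD x_le al_le) _.
by rewrite le_eqVlt; apply/orP; left; apply/eqP; ring.
Qed.

(** Here [n] stands for |x - x'|_C and [k] for |a - a'|: the maximum on the
    diagonal of [M_theta] serves both terms of the norm, the coefficient of [k]
    being 1 = (1/theta) theta. *)
Lemma le_max_weight (R : realType) (theta s n k : R) :
  0 < theta -> 0 <= n -> 0 <= k ->
  k + s * n <= Num.max (1 / theta) s * (n + theta * k).
Proof.
move=> theta_gt0 n_ge0 k_ge0; rewrite mulrDr addrC; apply: lerD.
  by rewrite ler_wpM2r // le_max lexx orbT.
by rewrite mulrA ler_peMl // -ler_pdivrMr // le_max lexx.
Qed.

Lemma le_mul_aug (R : realType) (theta s n k : R) :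
  0 < theta -> 0 <= s -> 0 <= k -> s * n <= s * (n + theta * k).
Proof.
by move=> theta_gt0 s_ge0 k_ge0; rewrite ler_wpM2l // lerDl mulr_ge0 // ltW.
Qed.

(** * The nonlocal problem *)

Lemma continuous_superposition (R : realType) (f : I01 R * (R * R) -> R)
    (x y : C01 R) :
  continuous f -> continuous (fun t : I01 R => f (t, (x t, y t))).
Proof.
move=> f_cont t.
apply: (@continuous_comp _ _ _ (fun t : I01 R => (t, (x t, y t))) f);
  last exact: f_cont.
have t_cvg : (t' : I01 R) @[t' --> t] --> t by exact: cvg_id.
have x_cvg := @C01_continuous R x t; have y_cvg := @C01_continuous R y t.
exact: (cvg_pair t_cvg (cvg_pair x_cvg y_cvg)).
Qed.

Lemma ivp_unique (R : realType) (x y : C01 R) (f : I01 R -> R) :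
  (forall t, has_derivative x t (f t)) ->
  (forall t, has_derivative y t (f t)) ->
  x (zero01 R) = y (zero01 R) -> x = y.
Proof.
move=> xf yf xy0; apply/normC_eq0/eqP; rewrite eq_le normC_ge0 andbT.
have ff0 t : `|f t - f t| <= 0 by rewrite subrr normr0.
by have := normC_ivp xf yf ff0; rewrite xy0 subrr normr0 addr0.
Qed.

Theorem theorem2p1 (R : realType)
  (f1 f2 : I01 R * (R * R) -> R) (alpha beta : C01 R * C01 R -> R)
  (a1 b1 a2 b2 A1 B1 A2 B2 : R)
  (f1_cont : continuous f1) (f2_cont : continuous f2)
  (alpha_cont : continuous alpha) (beta_cont : continuous beta)
  (a1_ge0 : 0 <= a1) (b1_ge0 : 0 <= b1) (a2_ge0 : 0 <= a2) (b2_ge0 : 0 <= b2)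
  (A1_ge0 : 0 <= A1) (B1_ge0 : 0 <= B1) (A2_ge0 : 0 <= A2) (B2_ge0 : 0 <= B2)
  (f1_lip : forall (t : I01 R) (x y x' y' : R),
    `|f1 (t, (x, y)) - f1 (t, (x', y'))| <= a1 * `|x - x'| + b1 * `|y - y'|)
  (f2_lip : forall (t : I01 R) (x y x' y' : R),
    `|f2 (t, (x, y)) - f2 (t, (x', y'))| <= a2 * `|x - x'| + b2 * `|y - y'|)
  (alpha_lip : forall x y x' y' : C01 R,
    `|alpha (x, y) - alpha (x', y')|
      <= A1 * normC (x \- x') + B1 * normC (y \- y'))
  (beta_lip : forall x y x' y' : C01 R,
    `|beta (x, y) - beta (x', y')|
      <= A2 * normC (x \- x') + B2 * normC (y \- y'))
  (M_theta_cvg : exists2 theta : R, 0 < theta &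
    convergent_to_zero (M_theta a1 b1 a2 b2 A1 B1 A2 B2 theta)) :
  exists! xy : C01 R * C01 R, is_solution f1 f2 alpha beta xy.
Proof.
have [theta theta_gt0 M_cvg0] := M_theta_cvg.
have theta_ge0 := ltW theta_gt0.
pose X : Type := ((C01 R * R) * (C01 R * R))%type.
pose ivp_solution (f : I01 R * (R * R) -> R) (z : X) (a : R) (x : C01 R) :=
  x (zero01 R) = a /\
  forall t : I01 R, has_derivative x t (f (t, (z.1.1 t, z.2.1 t))).
have ivp_ex f (f_cont : continuous f) z a : exists x, ivp_solution f z a x.
  exact: (antiderivative a (@continuous_superposition R f z.1.1 z.2.1 f_cont)).
have [P P_ivp] := choice (fun z : X => ivp_ex f1 f1_cont z z.1.2).
have [Q Q_ivp] := choice (fun z : X => ivp_ex f2 f2_cont z z.2.2).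
(* Fixed points of [T] are solutions paired with their initial values. *)
pose T (z : X) : X := ((P z, alpha (z.1.1, z.2.1)), (Q z, beta (z.1.1, z.2.1))).
pose D (z z' : X) (i : 'I_2) : R :=
  if i == 0 then aug_dist theta z.1 z'.1 else aug_dist theta z.2 z'.2.
have [z [Tz z_unique]] : exists! z, T z = z.
  have [c _] := antiderivative 0 (@cst_continuous (I01 R) R 0).
  apply: (@perov_fixed_point R 1 X D _ T ((c, 0), (c, 0)) _ _ _ _ _ _ M_cvg0).
  - by move=> z z' i; rewrite /D; case: ifP => _; exact: aug_dist_ge0.
  - move=> [p q] [p' q']; split=> [Dzz'|[-> ->] i]; last first.
      by rewrite /D; case: ifP => _; apply/aug_dist_eq0.
    have /(aug_dist_eq0 _ _ theta_gt0) /= -> := Dzz' 0.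
    by have /(aug_dist_eq0 _ _ theta_gt0) /= -> := Dzz' 1.
  - by move=> z z' i; rewrite /D !(aug_dist_sym _ z.1) !(aug_dist_sym _ z.2).
  - by move=> z z' z'' i; rewrite /D; case: ifP => _; exact: aug_dist_tri.
  - move=> u e e0 u_cauchy.
    have [p up] := aug_dist_complete theta_gt0 (u := fun m => (u m).1) e0
      (fun m k => u_cauchy m k 0).
    have [q uq] := aug_dist_complete theta_gt0 (u := fun m => (u m).2) e0
      (fun m k => u_cauchy m k 1).
    by exists (p, q) => i; rewrite /D; case: (i == 0).
  - move=> i j; rewrite mxE; do 2 case: ifP => _;
      by rewrite ?le_max ?divr_ge0 ?addr_ge0 ?mulr_ge0.
  move=> [p q] [p' q'] i.
  have [P0 P_der] := P_ivp (p, q); have [P0' P_der'] := P_ivp (p', q').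
  have [Q0 Q_der] := Q_ivp (p, q); have [Q0' Q_der'] := Q_ivp (p', q').
  rewrite !big_ord_recl big_ord0 addr0 !mxE /D /=; case: ifP => _.
    have := aug_dist_picard theta_gt0 a1_ge0 b1_ge0 f1_lip alpha_lip
      P_der P_der'.
    rewrite P0 P0' /= => /le_trans; apply; apply: lerD.
      by apply: le_max_weight => //; exact: normC_ge0.
    by apply: le_mul_aug => //; rewrite addr_ge0 // mulr_ge0 // ltW.
  have := aug_dist_picard theta_gt0 a2_ge0 b2_ge0 f2_lip beta_lip
    Q_der Q_der'.
  rewrite Q0 Q0' /= => /le_trans; apply; rewrite addrAC addrC; apply: lerD.
    by apply: le_mul_aug => //; rewrite addr_ge0 // mulr_ge0 // ltW.
  by apply: le_max_weight => //; exact: normC_ge0.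
move: z Tz z_unique => [[x a] [y b]] Tz z_unique.
have [P0 P_der] := P_ivp ((x, a), (y, b)).
have [Q0 Q_der] := Q_ivp ((x, a), (y, b)).
move: Tz; rewrite /T /= => -[Pz az Qz bz].
rewrite Pz /= in P0 P_der; rewrite Qz /= in Q0 Q_der.
exists (x, y); split.
  split; [split|exact: P_der|exact: Q_der|by rewrite P0|by rewrite Q0].
  - by exists (mkcts (@continuous_superposition R _ x y f1_cont)).
  - by exists (mkcts (@continuous_superposition R _ x y f2_cont)).
move=> [x' y'] [_ x'_der y'_der x'0 y'0].
pose z' : X := ((x', x' (zero01 R)), (y', y' (zero01 R))).
(* Any other solution, with its initial values, is also a fixed point of [T]. *)
suff /z_unique : T z' = z' by case=> -> _ -> _.
have [P0' P_der'] := P_ivp z'; have [Q0' Q_der'] := Q_ivp z'.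
rewrite /T (ivp_unique P_der' x'_der P0') (ivp_unique Q_der' y'_der Q0').
by rewrite /= -x'0 -y'0.
Qed.
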